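(* Let $p$ be an arbitrary prime number. Then the equation $x_1^2 + x_2^2 + x_3^2 + x_4^2 = p$ is solvable in integers $x_1, x_2, x_3, x_4 \in \mathbb{Z}$. *)

(* Defs.v *)
From mathcomp Require Export all_boot all_order all_algebra.

(* Main.v *)
Require Import Defs.
From mathcomp Require Import all_boot all_order all_algebra.
From mathcomp Require Import zify ring.
Import GRing.Theory Num.Theory.
Local Open Scope ring_scope.

(** Lagrange's descent.  Some multiple [m * p] with [0 < m < p] is a sum of four
    squares: two sets of more than [p / 2] residues, the squares and the
    numbers [- 1 - y ^+ 2], must meet modulo [p], so
    [a ^+ 2 + b ^+ 2 + 1 ^+ 2 + 0 ^+ 2] is a multiple of [p] for suitable small
    [a] and [b] ([small_multiple_sum4sq]).

    If [1 < m], replace the four numbers [x_i] by their residues [y_i] of least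
    absolute value modulo [m].  The sum of the [y_i ^+ 2] is [m * r] with
    [0 <= r <= m].  Euler's identity writes [(m * p) * (m * r)] as a sum of four
    squares, and the congruences [x_i = y_i] make all four of them multiples
    of [m ^+ 2]; so [r * p] is a sum of four squares ([euler_quotient]).  The
    extreme values [r = 0] and [r = m] would force [m] to divide [p]
    ([extreme_residues_dvd]), which is impossible for [1 < m < p].  Hence
    [0 < r < m], and the descent ends at [m = 1]. *)

Definition sum4sq (n : int) : Prop :=
  exists x1 x2 x3 x4 : int, x1 ^+ 2 + x2 ^+ 2 + x3 ^+ 2 + x4 ^+ 2 = n.

(** * A small multiple of p *)

(** A difference of squares is [(i - j) * (i + j)], and for distinct
    [i, j <= p / 2] both factors are nonzero and lie strictly between
    [- p] and [p], so [p] divides neither. *)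
Lemma sqr_Fp_inj (p : nat) : prime p ->
  injective (fun i : 'I_(p./2.+1) => (i%:R : 'F_p) ^+ 2).
Proof.
move=> p_pr; have Fp0 n : ((n%:R : 'F_p) == 0) = (p %| n)%N.
  by rewrite (dvdn_pcharf (pchar_Fp p_pr)).
have lt_neq (i j : nat) : (i < j <= p./2)%N ->
    (i%:R : 'F_p) ^+ 2 = j%:R ^+ 2 -> False.
  move=> /andP[lt_ij hj] /eqP; rewrite eq_sym -subr_eq0 subr_sqr mulf_eq0.
  have hp : (2 * p./2 <= p)%N by move: (odd_double_half p); lia.
  rewrite -natrB ?(ltnW lt_ij) // -natrD !Fp0.
  by case/orP=> /dvdn_leq; lia.
move=> [i hi] [j hj] eq_ij; apply: val_inj => /=.
case: (ltngtP i j) => // lt_ij; exfalso.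
  by apply: (lt_neq i j _ eq_ij); rewrite lt_ij.
by apply: (lt_neq j i _ (esym eq_ij)); rewrite lt_ij.
Qed.

(** The two sets of the pigeonhole argument both have [p./2.+1] elements, more
    than half of the residues.  This also covers [p = 2]. *)
Lemma sum_two_sqr_eqN1 (p : nat) : prime p ->
  exists a b : nat,
    [/\ (a <= p./2)%N, (b <= p./2)%N & (p %| a ^ 2 + b ^ 2 + 1)%N].
Proof.
move=> p_pr; pose f (i : 'I_(p./2.+1)) : 'F_p := i%:R ^+ 2.
pose g i := - 1 - f i.
have f_inj : injective f := sqr_Fp_inj p p_pr.
have g_inj : injective g by move=> i j /addrI/oppr_inj/f_inj.
have cardU : (#|(f @: setT) :|: (g @: setT)| <= p)%N.
  by rewrite (leq_trans (max_card _)) ?card_Fp.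
have [fg0|[_ /setIP[/imsetP[i _ ->] /imsetP[j _ fg]]]] :=
    set_0Vmem ((f @: setT) :&: (g @: setT)).
  move: cardU; rewrite cardsU fg0 cards0 subn0 !card_imset // cardsT card_ord.
  by move: (odd_double_half p); lia.
exists i, j; split; try by rewrite -ltnS.
rewrite (dvdn_pcharf (pchar_Fp p_pr)) !natrD !natrX.
by move: fg; rewrite /g /f => ->; apply/eqP; ring.
Qed.

Lemma small_multiple_sum4sq (p : nat) : prime p ->
  exists m : nat, (0 < m < p)%N /\ sum4sq (m%:Z * p%:Z).
Proof.
move=> p_pr; have [a [b [ha hb /dvdnP[m eq_m]]]] := sum_two_sqr_eqN1 p p_pr.
have p_gt1 := prime_gt1 p_pr.
have hp : (2 * p./2 <= p)%N by move: (odd_double_half p); lia.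
exists m; split; last first.
  exists a%:Z, b%:Z, 1, 0; rewrite -PoszM -eq_m !PoszD.
  by rewrite expr1n expr0n addr0 !expr2 -!PoszM.
have m_gt0 : (0 < m)%N by case: m eq_m => //; lia.
rewrite m_gt0 -(ltn_pmul2r (ltnW p_gt1)) -eq_m.
have sq_le c : (c <= p./2)%N -> (4 * c ^ 2 <= p ^ 2)%N.
  move=> hc; rewrite -[4%N]/(2 ^ 2)%N -expnMn leq_sqr.
  by apply: leq_trans hp; rewrite leq_mul2l.
have := sq_le a ha; have := sq_le b hb; have : (2 ^ 2 <= p ^ 2)%N by rewrite leq_sqr.
by rewrite !expnS !expn0 !muln1; lia.
Qed.

(** * Descent on the multiplier *)

Lemma centered_residue (m x : int) : 0 < m ->
  exists y c : int, x = y + m * c /\ - m <= 2 * y <= m.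
Proof.
move=> m_gt0; have eq_x := divz_eq x m.
have := modz_ge0 x (lt0r_neq0 m_gt0); have := ltz_pmod x m_gt0.
move: eq_x; set q := (x %/ m)%Z; set r := (x %% m)%Z => -> r_lt r_ge.
have [h|h] := lerP (2 * r) m.
  by exists r, q; split; [ring | lia].
by exists (r - m), (q + 1); split; [ring | lia].
Qed.

Lemma centered_sqr_bounds (m y : int) :
  - m <= 2 * y <= m -> 0 <= y ^+ 2 /\ 4 * y ^+ 2 <= m ^+ 2.
Proof.
move=> b; split; first exact: sqr_ge0.
rewrite -subr_ge0.
have -> : m ^+ 2 - 4 * y ^+ 2 = (m - 2 * y) * (m + 2 * y) by ring.
by apply: mulr_ge0; lia.
Qed.

Lemma sum4_bounds (a1 a2 a3 a4 s : int) :
  0 <= a1 /\ 4 * a1 <= s -> 0 <= a2 /\ 4 * a2 <= s ->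
  0 <= a3 /\ 4 * a3 <= s -> 0 <= a4 /\ 4 * a4 <= s ->
  0 <= a1 + a2 + a3 + a4 <= s.
Proof. by lia. Qed.

Lemma sum4_extreme (a1 a2 a3 a4 s : int) :
  0 <= a1 /\ 4 * a1 <= s -> 0 <= a2 /\ 4 * a2 <= s ->
  0 <= a3 /\ 4 * a3 <= s -> 0 <= a4 /\ 4 * a4 <= s ->
  a1 + a2 + a3 + a4 = 0 \/ a1 + a2 + a3 + a4 = s ->
  [/\ a1 = 0 \/ 4 * a1 = s, a2 = 0 \/ 4 * a2 = s,
      a3 = 0 \/ 4 * a3 = s & a4 = 0 \/ 4 * a4 = s].
Proof. by move=> b1 b2 b3 b4 [eq_s|eq_s]; split; lia. Qed.

(** In Euler's four-square identity for [x = y + m * c], the first form is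
    congruent to the sum of the [y_i ^+ 2] modulo [m] and the other three to
    [0]; all four can be divided by [m]. *)
Lemma euler_quotient (m r n y1 y2 y3 y4 c1 c2 c3 c4 : int) : m != 0 ->
  (y1 + m * c1) ^+ 2 + (y2 + m * c2) ^+ 2
    + (y3 + m * c3) ^+ 2 + (y4 + m * c4) ^+ 2 = m * n ->
  y1 ^+ 2 + y2 ^+ 2 + y3 ^+ 2 + y4 ^+ 2 = m * r ->
  sum4sq (r * n).
Proof.
move=> m_neq0 eq_x eq_y.
exists (r + c1 * y1 + c2 * y2 + c3 * y3 + c4 * y4),
  (c1 * y2 - c2 * y1 + c3 * y4 - c4 * y3),
  (c1 * y3 - c3 * y1 + c4 * y2 - c2 * y4),
  (c1 * y4 - c4 * y1 + c2 * y3 - c3 * y2).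
apply: (mulfI (expf_neq0 2 m_neq0)).
have -> : m ^+ 2 * (r * n) = (m * n) * (m * r) by ring.
rewrite -{1}eq_x -{1}eq_y.
have -> (a b c d : int) : m ^+ 2 * (a ^+ 2 + b ^+ 2 + c ^+ 2 + d ^+ 2)
    = (m * a) ^+ 2 + (m * b) ^+ 2 + (m * c) ^+ 2 + (m * d) ^+ 2 by ring.
(* [r] enters only through [m * r], the sum of the [y_i ^+ 2]; once that is
   substituted, Euler's identity remains. *)
by rewrite !(mulrDr m) -eq_y; ring.
Qed.

(** At the extreme values of [r] every [y_i] is [0], respectively [m / 2] up to
    sign.  Either way [m] divides [2 * y_i], hence [m ^+ 2] divides each
    [(y_i + m * c_i) ^+ 2 - y_i ^+ 2 = m * c_i * (2 * y_i + m * c_i)], and so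
    [m * n - m * r]. *)
Lemma extreme_residues_dvd (m r n y1 y2 y3 y4 c1 c2 c3 c4 : int) : 0 < m ->
  (y1 + m * c1) ^+ 2 + (y2 + m * c2) ^+ 2
    + (y3 + m * c3) ^+ 2 + (y4 + m * c4) ^+ 2 = m * n ->
  y1 ^+ 2 + y2 ^+ 2 + y3 ^+ 2 + y4 ^+ 2 = m * r ->
  - m <= 2 * y1 <= m -> - m <= 2 * y2 <= m ->
  - m <= 2 * y3 <= m -> - m <= 2 * y4 <= m ->
  r = 0 \/ r = m -> (m %| n)%Z.
Proof.
move=> m_gt0 eq_x eq_y b1 b2 b3 b4 r_ext.
have dvd_2y : [/\ (m %| 2 * y1)%Z, (m %| 2 * y2)%Z, (m %| 2 * y3)%Z
                & (m %| 2 * y4)%Z].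
  have dvd_of_sqr y : y ^+ 2 = 0 \/ 4 * y ^+ 2 = m ^+ 2 -> (m %| 2 * y)%Z.
    case=> [/eqP|eq_sq].
      by rewrite sqrf_eq0 => /eqP->; rewrite mulr0 dvdz0.
    have /eqP : (2 * y) ^+ 2 = m ^+ 2 by rewrite -eq_sq; ring.
    by rewrite eqf_sqr => /orP[]/eqP->; rewrite // dvdzE abszN dvdnn.
  have sum_ext : y1 ^+ 2 + y2 ^+ 2 + y3 ^+ 2 + y4 ^+ 2 = 0 \/
                 y1 ^+ 2 + y2 ^+ 2 + y3 ^+ 2 + y4 ^+ 2 = m ^+ 2.
    by case: r_ext eq_y => -> ->; [left; rewrite mulr0 | right].
  by have [] := sum4_extreme _ _ _ _ _ (centered_sqr_bounds _ _ b1)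
    (centered_sqr_bounds _ _ b2) (centered_sqr_bounds _ _ b3)
    (centered_sqr_bounds _ _ b4) sum_ext; split; apply: dvd_of_sqr.
case: dvd_2y => /dvdzP[d1 e1] /dvdzP[d2 e2] /dvdzP[d3 e3] /dvdzP[d4 e4].
have eq_nr : n = r + m * (c1 * (d1 + c1) + c2 * (d2 + c2)
                        + c3 * (d3 + c3) + c4 * (d4 + c4)).
  apply: (mulfI (lt0r_neq0 m_gt0)); rewrite -eq_x mulrDr -eq_y.
  have -> : m * (m * (c1 * (d1 + c1) + c2 * (d2 + c2)
                   + c3 * (d3 + c3) + c4 * (d4 + c4)))
    = m * (c1 * (d1 * m + m * c1) + c2 * (d2 * m + m * c2)
         + c3 * (d3 * m + m * c3) + c4 * (d4 * m + m * c4)) by ring.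
  by rewrite -e1 -e2 -e3 -e4; ring.
rewrite eq_nr rpredD ?dvdz_mulr //.
by case: r_ext => ->; rewrite ?dvdz0 ?dvdzz.
Qed.

Lemma descent_step (p m : nat) : prime p -> (1 < m < p)%N ->
  sum4sq (m%:Z * p%:Z) ->
  exists r : nat, (0 < r < m)%N /\ sum4sq (r%:Z * p%:Z).
Proof.
move=> p_pr /andP[m_gt1 m_ltp] [x1 [x2 [x3 [x4 eq_x]]]].
have m_gt0 : 0 < m%:Z by lia.
have [y1 [c1 [ex1 b1]]] := centered_residue m%:Z x1 m_gt0.
have [y2 [c2 [ex2 b2]]] := centered_residue m%:Z x2 m_gt0.
have [y3 [c3 [ex3 b3]]] := centered_residue m%:Z x3 m_gt0.
have [y4 [c4 [ex4 b4]]] := centered_residue m%:Z x4 m_gt0.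
subst x1 x2 x3 x4.
(* The sum of the [x_i ^+ 2 = (y_i + m * c_i) ^+ 2] is [m * p]; solving for the
   sum of the [y_i ^+ 2] gives [m] times this [r]. *)
pose r : int := p%:Z - 2 * (y1 * c1 + y2 * c2 + y3 * c3 + y4 * c4)
  - m%:Z * (c1 ^+ 2 + c2 ^+ 2 + c3 ^+ 2 + c4 ^+ 2).
have eq_y : y1 ^+ 2 + y2 ^+ 2 + y3 ^+ 2 + y4 ^+ 2 = m%:Z * r.
  by rewrite /r !mulrBr -eq_x; ring.
have not_dvd : ~ (m%:Z %| p%:Z)%Z.
  by rewrite dvdzE => /(prime_nt_dvdP p_pr); clear -m_gt1 m_ltp; lia.
have not_ext : ~ (r = 0 \/ r = m%:Z).
  by move=> /(extreme_residues_dvd _ _ _ _ _ _ _ _ _ _ _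
                m_gt0 eq_x eq_y b1 b2 b3 b4).
have r_bounds : 0 <= r <= m%:Z.
  have := sum4_bounds _ _ _ _ _ (centered_sqr_bounds _ _ b1)
    (centered_sqr_bounds _ _ b2) (centered_sqr_bounds _ _ b3)
    (centered_sqr_bounds _ _ b4).
  by rewrite eq_y expr2 pmulr_rge0 // ler_pM2l.
have := euler_quotient _ _ _ _ _ _ _ _ _ _ _ (lt0r_neq0 m_gt0) eq_x eq_y.
move: r r_bounds not_ext {eq_y} => [r|r] r_bounds not_ext; last by [].
by exists r; split=> //; clear -r_bounds not_ext; lia.
Qed.

Lemma sum4sq_descent (p m : nat) : prime p -> (0 < m < p)%N ->
  sum4sq (m%:Z * p%:Z) -> sum4sq p%:Z.
Proof.
move=> p_pr; elim/ltn_ind: m => m IHm /andP[m_gt0 m_ltp] sum_mp.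
have [m1|m_neq1] := eqVneq m 1%N; first by rewrite m1 mul1r in sum_mp.
have [|r [/andP[r_gt0 r_ltm] sum_rp]] := descent_step p m p_pr _ sum_mp.
  by rewrite m_ltp; lia.
by apply: (IHm r) => //; lia.
Qed.

Theorem theorem1 (p : nat) (hp : prime p) :
  exists x1 x2 x3 x4 : int,
    x1 ^+ 2 + x2 ^+ 2 + x3 ^+ 2 + x4 ^+ 2 = p%:Z.
Proof.
have [m [m_bounds sum_mp]] := small_multiple_sum4sq p hp.
exact: sum4sq_descent hp m_bounds sum_mp.
Qed.
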